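(* Let $q,w\in L^1[-1,1]$ be real-valued with $q(x)=q(-x)$ and $w(-x)=-w(x)$ for a.e. $x$, and $xw(x)>0$ for a.e. $x\in[-1,1]$. Suppose there are constants $q_0<0$ and $w_0>0$ with $q(x)\ge q_0$ and $|w(x)|\ge w_0$ for a.e. $x\in[-1,1]$. Then every purely imaginary eigenvalue $\lambda$ (i.e. $\lambda=i\alpha$, $\alpha\in\mathbb{R}\setminus\{0\}$) of the problem $-y''+qy=\lambda wy$, $y(-1)=y(1)=0$, satisfies $$|\operatorname{Im}\lambda|\le \frac{4(-q_0)^{3/2}}{w_0}.$$
   Context: A number $\lambda\in\mathbb{C}$ is an eigenvalue of $-y''+qy=\lambda wy$, $y(-1)=y(1)=0$, if there is a nontrivial function $y$ with $y,y'$ absolutely continuous on $[-1,1]$ satisfying $-y''+qy=\lambda wy$ a.e. on $[-1,1]$ and $y(-1)=y(1)=0$. *)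

(* Defs.v *)
From HB Require Import structures.
From mathcomp Require Import all_boot all_order all_algebra.
From mathcomp Require Import all_classical all_reals all_analysis.
From mathcomp Require Import complex.
Set Implicit Arguments. Unset Strict Implicit. Unset Printing Implicit Defensive.
Import Order.TTheory GRing.Theory Num.Theory.
Import numFieldNormedType.Exports.
Local Open Scope classical_set_scope.
Local Open Scope ring_scope.

Definition abs_cont_on (R : realType) (a b : R) (f : R -> R) : Prop :=
  forall e : R, 0 < e -> exists2 d : R, 0 < d &
    forall (n : nat) (I : 'I_n -> R * R),
      (forall i, a <= (I i).1 /\ (I i).1 <= (I i).2 /\ (I i).2 <= b) ->
      (forall i j, i != j -> (I i).2 <= (I j).1 \/ (I j).2 <= (I i).1) ->
      \sum_(i < n) ((I i).2 - (I i).1) < d ->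
      \sum_(i < n) `|f (I i).2 - f (I i).1| < e.

(* A complex-valued function y = u + i v is absolutely continuous iff its
   real and imaginary parts are. *)

(* lam is an eigenvalue of -y'' + q y = lam w y, y(-1) = y(1) = 0.
   y = u + i v, y' = u1 + i v1; y'' is the (a.e. existing) derivative of y'. *)
Definition is_eigenvalue (R : realType) (q w : R -> R) (lam : R[i]) : Prop :=
  exists u v u1 v1 : R -> R,
    [/\ abs_cont_on (-1) 1 u, abs_cont_on (-1) 1 v,
        abs_cont_on (-1) 1 u1 & abs_cont_on (-1) 1 v1] /\
    {ae (@lebesgue_measure R), forall x : R, `[-1, 1]%classic x ->
        is_derive x 1 u (u1 x) /\ is_derive x 1 v (v1 x)} /\
    {ae (@lebesgue_measure R), forall x : R, `[-1, 1]%classic x ->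
        [/\ derivable u1 x 1, derivable v1 x 1 &
        (- ((derive1 u1 x) +i* (derive1 v1 x)) + (q x)%:C * (u x +i* v x)
          = lam * (w x)%:C * (u x +i* v x))%C]} /\
    [/\ u (-1) = 0, v (-1) = 0, u 1 = 0 & v 1 = 0] /\
    (exists2 x, `[-1, 1]%classic x & u x != 0 \/ v x != 0).

(* Main.v *)
Require Import Defs.
From HB Require Import structures.
From mathcomp Require Import all_boot all_order all_algebra.
From mathcomp Require Import all_classical all_reals all_analysis.
From mathcomp Require Import complex ring lra.
Set Implicit Arguments. Unset Strict Implicit. Unset Printing Implicit Defensive.
Import Order.TTheory GRing.Theory Num.Theory.
Import numFieldNormedType.Exports.
Local Open Scope classical_set_scope.
Local Open Scope ring_scope.

(* With y = u + i v and Q = - q0, let ||.|| be the L^2 norm on [-1, 1]. Testing the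
   equation against conj y gives ||y'||^2 <= Q ||y||^2. Testing its imaginary part
   against x conj y gives, since x w >= w0 |x|,
     |alpha| w0 \int |x| |y|^2 <= ||y|| ||y'|| <= sqrt Q ||y||^2.
   The sup bound |y|^2 <= ||y|| ||y'|| <= sqrt Q ||y||^2 prevents |y|^2 from
   concentrating at 0: \int |x| |y|^2 >= ||y||^2 / (4 sqrt Q). Hence
   |alpha| w0 <= 4 Q, and Q <= Q^(3/2) because Poincare's inequality forces Q >= 1.
   Integrals are replaced by monotonicity: every estimate says that an explicit
   absolutely continuous function with a.e. nonnegative derivative takes a smaller
   value at -1 than at 1. *)

(** * Monotonicity from an almost everywhere nonnegative derivative *)

(** Cousin's lemma as an induction principle. The points [x] with [P a x] have a supremum, and the
    local hypothesis there both reaches it and, if it were less than [b], passes beyond it. *)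
Lemma cousin_ind (R : realType) (a b : R) (P : R -> R -> Prop) :
  a <= b ->
  (forall x y z, x <= y -> y <= z -> P x y -> P y z -> P x z) ->
  (forall x, a <= x <= b -> exists2 d : R, 0 < d & forall s t,
     a <= s -> s <= x -> x <= t -> t <= b -> t - s < d -> P s t) ->
  P a b.
Proof.
move=> ab Padd Ploc.
pose S := [set x : R | a <= x <= b /\ P a x].
have Sa : S a.
  have aab : a <= a <= b by rewrite lexx.
  split => //; have [d d0] := Ploc _ aab.
  by apply; rewrite ?lexx// subrr.
have Sb : ubound S b by move=> x [/andP[]].
have supS : has_sup S by split; [exists a|exists b].
have sab : a <= sup S <= b.
  by rewrite (ub_le_sup (proj2 supS) Sa) /= ge_sup//; exists a.
have [d d0 Pd] := Ploc _ sab.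
have d2 : 0 < d / 2 by rewrite divr_gt0.
have [x [/andP[ax xb] Px] xs] := sup_adherent d2 supS.
have xS : x <= sup S by apply: ub_le_sup; [exact: (proj2 supS)|split; rewrite ?ax].
(* As [x] is within [d / 2] of the supremum and [t] at most [d / 3] beyond it, [t - x < d]. *)
pose t := Num.min b (sup S + d / 3).
have st : sup S <= t.
  by rewrite le_min (andP sab).2/= lerDl divr_ge0// ltW.
have tb : t <= b by rewrite ge_min lexx.
have td : t <= sup S + d / 3 by rewrite ge_min lexx orbT.
have Pt : P a t.
  apply: (Padd _ x) => //; first exact: le_trans st.
  by apply: Pd => //; lra.
have : t <= sup S.
  apply: ub_le_sup; first exact: (proj2 supS).
  by split=> //; rewrite tb andbT (le_trans ax)// (le_trans xS).
move=> ts; suff <- : t = b by [].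
apply/min_idPl; rewrite leNgt; apply/negP => /ltW /min_idPr tE.
by move: ts; rewrite /t tE; move: d0; clear; lra.
Qed.

Lemma is_derive_approx (R : realType) (f : R -> R) (x l e : R) :
  0 < e -> is_derive x 1 f l ->
  exists2 d : R, 0 < d & forall t, `|t - x| < d ->
    `|f t - f x - l * (t - x)| <= e * `|t - x|.
Proof.
move=> e0 [df dfl].
have : h^-1 *: (f (h *: (1 : R) + x) - f x) @[h --> (0 : R)^'] --> l.
  by rewrite -dfl; exact: df.
move=> /cvgrPdist_le /(_ _ e0) [d /= d0 Hd]; exists d => // t txd.
have [->|tx] := eqVneq t x; first by rewrite !subrr mulr0 subrr normr0 mulr0.
have tx0 : t - x != 0 by rewrite subr_eq0.
have := Hd (t - x); rewrite /= sub0r normrN => /(_ txd tx0).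
rewrite [_ *: 1]mulr1 subrK => H.
have -> : f t - f x - l * (t - x) = - ((l - (t - x)^-1 *: (f t - f x)) * (t - x)).
  by rewrite /GRing.scale /=; field.
by rewrite normrN normrM ler_wpM2r.
Qed.

(** Ordered lists of intervals, unlike families over ['I_n], concatenate easily, which suits the
    additivity step of the Cousin induction. *)
Lemma abs_cont_seq (R : realType) (a b : R) (f : R -> R) :
  abs_cont_on a b f ->
  forall e : R, 0 < e -> exists2 d : R, 0 < d &
    forall s : seq (R * R),
      all (fun p => (a <= p.1) && (p.1 <= p.2) && (p.2 <= b)) s ->
      pairwise (fun p q : R * R => p.2 <= q.1) s ->
      \sum_(p <- s) (p.2 - p.1) < d ->
      \sum_(p <- s) `|f p.2 - f p.1| < e.
Proof.
move=> acf e e0; have [d d0 H] := acf _ e0; exists d => // s /all_nthP sab.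
move=> /(pairwiseP (0, 0)) spw.
rewrite !(big_nth (0, 0)) !big_mkord; apply: H => [i|i j ij].
  by have := sab (0, 0) i (ltn_ord i) => /andP[/andP[]].
have [lij|lji|/val_inj eij] := ltngtP i j.
- by left; apply: spw => //; exact: ltn_ord.
- by right; apply: spw => //; exact: ltn_ord.
- by rewrite eij eqxx in ij.
Qed.

Lemma abs_cont_on_sub (R : realType) (a b a' b' : R) (f : R -> R) :
  a <= a' -> b' <= b -> abs_cont_on a b f -> abs_cont_on a' b' f.
Proof.
move=> aa bb acf e /acf[d d0 H]; exists d => // n I Iab.
apply: H => i; have [h1 [h2 h3]] := Iab i.
by split; [exact: le_trans h1|split=> //; exact: le_trans bb].
Qed.

(* Cousin partition: tags outside the exceptional null set are controlled by
   the derivative, those inside it span intervals contained in an open set of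
   small measure and are controlled by absolute continuity. *)
Lemma abs_cont_ae_ge0_le (R : realType) (a b : R) (f : R -> R) :
  a <= b -> abs_cont_on a b f ->
  {ae (@lebesgue_measure R), forall x, `[a, b]%classic x ->
     exists2 l : R, 0 <= l & is_derive x 1 f l} ->
  f a <= f b.
Proof.
move=> ab acf [N [mN N0 subN]].
apply/ler_addgt0Pr => e0 e00.
(* The error [e0] splits into [e * (b - a)], lost at the differentiability tags, and [e], lost on
   the exceptional intervals. *)
set e := e0 / (b - a + 1).
have ba1 : 0 < b - a + 1 by lra.
have e_gt0 : 0 < e by rewrite divr_gt0.
suff : f a <= f b + e * (b - a) + e.
  have -> : e0 = e * (b - a + 1) by rewrite /e; field; rewrite gt_eqF.
  by move=> ?; lra.
have [d d0 Hd] := abs_cont_seq acf e_gt0.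
have N_fin : (lebesgue_measure N < +oo)%E by rewrite N0 ltry.
have [U [oU NU muU]] := lebesgue_regularity_outer mN N_fin d0.
have mU : measurable U by exact: measurable_realfun.open_measurable.
have {}muU : (lebesgue_measure U < d%:E)%E.
  rewrite (le_lt_trans _ muU)// -(setDUK NU).
  rewrite (le_trans (measureU2 _ _ _))//; first exact: measurableD.
  by rewrite setDUK// [X in (X + _)%E]N0 add0e.
(* The list [s] records the exceptional intervals. Half-open intervals make the measures on adjacent
   pieces add up without overlap. *)
pose P x y := exists s : seq (R * R),
  [/\ all (fun p => (x <= p.1) && (p.1 <= p.2) && (p.2 <= y)) s,
      pairwise (fun p q : R * R => p.2 <= q.1) s,
      ((\sum_(p <- s) (p.2 - p.1))%:E <=
         lebesgue_measure (U `&` `]x, y]%classic))%E &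
      f x <= f y + e * (y - x) + \sum_(p <- s) `|f p.2 - f p.1|].
suff [s [sab spw sU fs]] : P a b.
  rewrite (le_trans fs)// lerD2l ltW// Hd//.
  rewrite -lte_fin (le_lt_trans sU)// (le_lt_trans _ muU)//.
  by rewrite le_measure// ?inE//; exact: measurableI.
apply: cousin_ind => // [x y z xy yz [s [s1 s2 s3 s4]] [t [t1 t2 t3 t4]]|x xab].
  exists (s ++ t); split.
  - rewrite all_cat; apply/andP; split.
      apply: sub_all s1 => p /andP[-> /=] h; exact: le_trans yz.
    apply: sub_all t1 => p /andP[/andP[h -> ->]]; rewrite !andbT; exact: le_trans h.
  - rewrite pairwise_cat s2 t2 !andbT; apply/allrelP => p q /(allP s1) /andP[_ h].
    by move=> /(allP t1) /andP[/andP[+ _] _]; exact: le_trans.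
  - rewrite big_cat /= EFinD (le_trans (leeD s3 t3))// -measureU//=.
    + by rewrite -setIUr -itv_bndbnd_setU//.
    + exact: measurableI.
    + exact: measurableI.
    + rewrite setIACA setIid -subset0 => u /= [_]; rewrite !in_itv /=.
      by move=> [/andP[_ uy] /andP[yu _]]; move: (lt_le_trans yu uy); rewrite ltxx.
  - by rewrite big_cat /=; lra.
(* The split is on the open set [U]: a tag in [U] has a neighbourhood in [U], so its interval is
   recorded; any other tag avoids [N], so the derivative exists there and nothing is recorded. *)
have [Ux|nUx] := pselect (U x).
  have /nbhs_ballP[r /= r0 rU] : nbhs x U by exact: open_nbhs_nbhs.
  exists r => // s t _ sx xt _ tsr.
  have stU : `]s, t]%classic `<=` U.
    move=> u /=; rewrite in_itv /= => /andP[su ut]; apply: rU.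
    by rewrite /ball /= ltr_norml; apply/andP; split; lra.
  have st : s <= t by exact: le_trans xt.
  exists [:: (s, t)]; split; rewrite ?big_seq1 //= ?lexx ?st //.
    rewrite setIidr// lebesgue_measure_itv /= lte_fin.
    by case: ltP => // h; rewrite lee_fin; lra.
  have := ler_norm (- (f t - f s)); rewrite normrN => h.
  have : 0 <= e * (t - s) by rewrite mulr_ge0 ?subr_ge0// ltW.
  by move=> h2; lra.
have [l l0 /(is_derive_approx e_gt0)[r r0 Hr]] : exists2 l : R, 0 <= l & is_derive x 1 f l.
  apply: contrapT => nh; apply: nUx; apply: NU; apply: subN => /= h.
  by apply: nh; apply: h; rewrite /= in_itv.
exists r => // s t _ sx xt _ tsr; exists [::]; split; rewrite ?big_nil//=.
have /Hr : `|s - x| < r by rewrite ler0_norm; lra.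
have /Hr : `|t - x| < r by rewrite ger0_norm; lra.
rewrite (ger0_norm (x := t - x)) ?subr_ge0// (ler0_norm (x := s - x)) ?subr_le0//.
rewrite !ler_norml => /andP[h1 _] /andP[_ h2].
have : 0 <= l * (t - x) by rewrite mulr_ge0// subr_ge0.
have : 0 <= l * (x - s) by rewrite mulr_ge0// subr_ge0.
by move=> h3 h4; lra.
Qed.

(** * Calculus of absolutely continuous functions *)

Lemma abs_cont_onD (R : realType) (a b : R) (f g : R -> R) :
  abs_cont_on a b f -> abs_cont_on a b g ->
  abs_cont_on a b (fun x => f x + g x).
Proof.
move=> acf acg e e0; have e2 : 0 < e / 2 by rewrite divr_gt0.
have [d1 d10 H1] := acf _ e2; have [d2 d20 H2] := acg _ e2.
exists (Num.min d1 d2) => [|n I Iab Idis]; first by rewrite lt_min d10.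
rewrite lt_min => /andP[/(H1 _ _ Iab Idis) h1 /(H2 _ _ Iab Idis) h2].
have -> : e = e / 2 + e / 2 by lra.
apply: le_lt_trans (ltrD h1 h2); rewrite -big_split/= ler_sum// => i _.
by rewrite opprD addrACA ler_normD.
Qed.

Lemma abs_cont_on_unif_continuous (R : realType) (a b : R) (f : R -> R) :
  abs_cont_on a b f -> forall e : R, 0 < e -> exists2 d : R, 0 < d &
    forall x y, a <= x <= b -> a <= y <= b -> `|y - x| < d -> `|f y - f x| < e.
Proof.
move=> acf e e0; have [d d0 H] := acf _ e0; exists d => //.
have W x y : a <= x <= b -> a <= y <= b -> x <= y -> y - x < d ->
    `|f y - f x| < e.
  move=> /andP[ax xb] /andP[ay yb] xy yxd.
  have := H 1 (fun _ => (x, y)); rewrite !big_ord1; apply => //= i j.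
  by rewrite !ord1 eqxx.
move=> x y xab yab; have [xy|/ltW yx] := leP x y.
  by rewrite ger0_norm ?subr_ge0//; exact: W.
by rewrite ler0_norm ?subr_le0// opprB [`|f y - _|]distrC; exact: W.
Qed.

(** Precomposing with the clamp onto [[a, b]], which is 1-Lipschitz, preserves uniform
    continuity. *)
Lemma abs_cont_on_continuous_extension (R : realType) (a b : R) (f : R -> R) :
  a <= b -> abs_cont_on a b f ->
  exists g : R -> R, continuous g /\ forall x, a <= x <= b -> g x = f x.
Proof.
move=> ab acf; pose c x := Num.max a (Num.min b x).
have cab x : a <= c x <= b by rewrite le_max lexx/= ge_max ab ge_min lexx.
exists (f \o c); split => [x|x /andP[ax xb]] /=; last first.
  by rewrite /c (min_idPr xb) (max_idPr ax).
apply/cvgrPdist_lt => e e0.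
have [d d0 H] := abs_cont_on_unif_continuous acf e0.
exists d => //= y xyd; apply: H => //; apply: le_lt_trans xyd.
rewrite /c.
case: (leP b x) => bx; case: (leP b y) => yb; rewrite ?(max_idPr ab);
  do ?[case: (leP a x) => ax]; do ?[case: (leP a y) => ay];
  case: (ger0P (x - y)) => h3; rewrite ?ler_norml; try (apply/andP; split); lra.
Qed.

Lemma abs_cont_on_bounded (R : realType) (a b : R) (f : R -> R) :
  a <= b -> abs_cont_on a b f ->
  exists2 K : R, 0 < K & forall x, a <= x <= b -> `|f x| <= K.
Proof.
move=> ab /(abs_cont_on_continuous_extension ab)[g [gc gf]].
have ngc : {within `[a, b], continuous (fun x => `|g x|)}.
  apply: continuous_subspaceT => x.
  by apply: (continuous_comp (gc x)); exact: norm_continuous.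
have [c _ cmax] := EVT_max ab ngc.
exists (`|g c| + 1) => [|x xab]; first by rewrite ltr_wpDl.
rewrite -gf// (le_trans (cmax _ _))//; last by rewrite lerDl.
Qed.

Lemma abs_cont_onM (R : realType) (a b : R) (f g : R -> R) :
  a <= b -> abs_cont_on a b f -> abs_cont_on a b g ->
  abs_cont_on a b (fun x => f x * g x).
Proof.
move=> ab acf acg e e0.
have [K K0 fK] := abs_cont_on_bounded ab acf.
have [L L0 gL] := abs_cont_on_bounded ab acg.
have e1 : 0 < e / (2 * L) by rewrite divr_gt0// mulr_gt0.
have e2 : 0 < e / (2 * K) by rewrite divr_gt0// mulr_gt0.
have [d1 d10 H1] := acf _ e1; have [d2 d20 H2] := acg _ e2.
exists (Num.min d1 d2) => [|n I Iab Idis]; first by rewrite lt_min d10.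
rewrite lt_min => /andP[/(H1 _ _ Iab Idis) h1 /(H2 _ _ Iab Idis) h2].
have -> : e = (e / (2 * L)) * L + K * (e / (2 * K)).
  by field; rewrite !gt_eqF.
move: h1 h2; rewrite -(ltr_pM2r L0) -[in X in _ -> X -> _](ltr_pM2l K0) => h1 h2.
apply: le_lt_trans (ltrD h1 h2).
rewrite mulr_suml mulr_sumr -big_split/= ler_sum// => i _.
have [h [h' h'']] := Iab i.
have -> : f (I i).2 * g (I i).2 - f (I i).1 * g (I i).1 =
    (f (I i).2 - f (I i).1) * g (I i).2 + f (I i).1 * (g (I i).2 - g (I i).1).
  by ring.
rewrite (le_trans (ler_normD _ _))// !normrM lerD//.
  by rewrite ler_wpM2l// gL// h'' (le_trans h).
by rewrite ler_wpM2r// fK// h (le_trans h').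
Qed.

Lemma abs_cont_on_derive (R : realType) (a b K : R) (f df : R -> R) :
  (forall x, a <= x <= b -> is_derive x 1 f (df x)) ->
  (forall x, a <= x <= b -> `|df x| <= K) ->
  abs_cont_on a b f.
Proof.
(* By the mean value theorem [|K| + 1] is a Lipschitz constant; it is positive even for [K = 0]. *)
move=> dfE dfK e e0; exists (e / (`|K| + 1)) => [|n I Iab _].
  by rewrite divr_gt0// ltr_wpDl.
rewrite ltr_pdivlMr ?ltr_wpDl//; apply: le_lt_trans.
rewrite mulr_suml ler_sum// => i _; have [h [h' h'']] := Iab i.
have sub z : z \in `[(I i).1, (I i).2] -> a <= z <= b.
  rewrite in_itv/= => /andP[h1 h2]; apply/andP; split; first exact: le_trans h1.
  exact: le_trans h''.
have [||z /sub zab ->] := @MVT_segment R f df _ _ h'.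
- move=> z /subset_itv_oo_cc /sub; exact: dfE.
- apply: derivable_within_continuous => z /sub zab.
  by have [] := dfE _ zab.
rewrite normrM mulrC ger0_norm ?subr_ge0// ler_wpM2l ?subr_ge0//.
by rewrite (le_trans (dfK _ zab))// (le_trans (ler_norm K))// lerDl.
Qed.

Lemma abs_cont_on_cst (R : realType) (a b k : R) : abs_cont_on a b (fun=> k).
Proof.
by apply: (@abs_cont_on_derive _ _ _ 0 _ (fun=> 0)) => x _; rewrite normr0.
Qed.

Lemma abs_cont_on_id (R : realType) (a b : R) : abs_cont_on a b (fun x => x).
Proof.
by apply: (@abs_cont_on_derive _ _ _ 1 _ (fun=> 1)) => x _; rewrite normr1.
Qed.

Lemma abs_cont_onB (R : realType) (a b : R) (f g : R -> R) :
  a <= b -> abs_cont_on a b f -> abs_cont_on a b g ->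
  abs_cont_on a b (fun x => f x - g x).
Proof.
move=> ab acf acg; apply: abs_cont_onD => //.
rewrite [X in abs_cont_on _ _ X](_ : _ = fun x => (-1) * g x).
  by apply: abs_cont_onM => //; exact: abs_cont_on_cst.
by apply/funext => x; rewrite mulN1r.
Qed.

Lemma abs_cont_on_primitive (R : realType) (a b : R) (f : R -> R) :
  a <= b -> abs_cont_on a b f ->
  exists F : R -> R, [/\ F a = 0, abs_cont_on a b F &
    forall x, a <= x <= b -> is_derive x 1 F (f x)].
Proof.
move=> ab acf; have [g [gc gf]] := abs_cont_on_continuous_extension ab acf.
have [K _ fK] := abs_cont_on_bounded ab acf.
(* Starting at [a - 1] makes [a] an interior point, so the derivative there is two-sided. *)
pose G x := (\int[@lebesgue_measure R]_(t in `[a - 1, x]) g t)%R.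
have dG x : a <= x <= b -> is_derive x 1 (G - cst (G a)) (f x).
  move=> xab; have xx1 : x < x + 1 by rewrite ltrDl.
  have ax : a - 1 < x by case/andP: xab => ? _; lra.
  have gi : (@lebesgue_measure R).-integrable `[a - 1, x + 1] (EFin \o g).
    apply: continuous_compact_integrable; first exact: segment_compact.
    exact: continuous_subspaceT.
  have [dG GE] := continuous_FTC1_closed xx1 gi ax (gc x).
  rewrite -gf// -GE derive1E -[X in is_derive _ _ _ X]subr0.
  by apply: is_deriveB; exact/derivableP.
exists (G - cst (G a)); split => //; first by rewrite fctE subrr.
exact: abs_cont_on_derive dG fK.
Qed.

Lemma abs_cont_on_norm (R : realType) (a b : R) :
  abs_cont_on a b (fun x : R => `|x|).
Proof.
move=> e e0; exists e => // n I Iab _; apply: le_lt_trans.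
apply: ler_sum => i _; have [_ [h _]] := Iab i.
by rewrite (le_trans (ler_dist_dist _ _))// ger0_norm// subr_ge0.
Qed.

Ltac abs_cont_tac := repeat first
  [ eassumption | exact: abs_cont_on_id | exact: abs_cont_on_cst
  | exact: abs_cont_on_norm
  | simple apply abs_cont_onB | simple apply abs_cont_onD
  | simple apply abs_cont_onM ].

(** * Monotonicity criteria and the first moment of a bounded density *)

(** The form in which monotonicity is applied: [A] carries the almost everywhere information, and
    computing the derivative is separated from checking its sign. *)
Lemma abs_cont_on_ae_le (R : realType) (a b c d : R) (F dF : R -> R)
    (A : R -> Prop) :
  a <= c -> c <= d -> d <= b -> abs_cont_on a b F ->
  {ae (@lebesgue_measure R), forall x : R, `[a, b]%classic x -> A x} ->
  (forall x : R, c <= x <= d -> A x -> is_derive x 1 F (dF x)) ->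
  (forall x : R, c <= x <= d -> A x -> 0 <= dF x) ->
  F c <= F d.
Proof.
move=> ac cd db acF [N [mN N0 subN]] dFE dF0.
apply: abs_cont_ae_ge0_le => //; first exact: abs_cont_on_sub acF.
exists N; split => //; apply: subset_trans subN; apply: subsetC => x /= Ax.
rewrite in_itv /= => xcd; have {}Ax : A x.
  apply: Ax; rewrite in_itv /=; case/andP: xcd => cx xd.
  by rewrite (le_trans ac)// (le_trans xd).
by exists (dF x); [exact: dF0|exact: dFE].
Qed.

Lemma is_derive_ge0_le (R : realType) (a b : R) (F dF : R -> R) :
  a <= b -> (forall x : R, a <= x <= b -> is_derive x 1 F (dF x)) ->
  (forall x : R, a <= x <= b -> 0 <= dF x) -> F a <= F b.
Proof.
move=> ab dFE dF0; rewrite -subr_ge0.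
have [||x xab ->] := @MVT_segment R F dF _ _ ab.
- by move=> x /subset_itv_oo_cc; rewrite in_itv; exact: dFE.
- apply: derivable_within_continuous => x; rewrite in_itv => xab.
  by have [] := dFE _ xab.
by rewrite mulr_ge0 ?subr_ge0// dF0//; rewrite in_itv in xab.
Qed.

(* Among densities [p <= M] of given mass, [\int |x| p] is smallest when [p = M]
   on an interval centred at 0; [c] plays the role of a multiplier. *)
Lemma first_moment_ge (R : realType) (p P T : R -> R) (M c : R) :
  0 <= c <= 1 ->
  (forall x : R, -1 <= x <= 1 -> 0 <= p x <= M) ->
  (forall x : R, -1 <= x <= 1 -> is_derive x 1 P (p x)) ->
  (forall x : R, -1 <= x <= 1 -> is_derive x 1 T (`|x| * p x)) ->
  c * (P 1 - P (-1)) - M * (c * c) <= T 1 - T (-1).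
Proof.
move=> /andP[c0 c1] p0M dP dT.
have sub (a b x : R) : -1 <= a -> b <= 1 -> a <= x <= b -> -1 <= x <= 1.
  by move=> a1 b1 /andP[ax xb]; rewrite (le_trans a1)// (le_trans xb).
pose F x := T x - c * P x.
have outer (a b : R) : -1 <= a -> a <= b -> b <= 1 ->
    (forall x : R, a <= x <= b -> c <= `|x|) -> F a <= F b.
  move=> a1 ab b1 cx.
  apply: (@is_derive_ge0_le _ _ _ F (fun x => (`|x| - c) * p x)) => // x xab.
    have ? := dP _ (sub _ _ _ a1 b1 xab); have ? := dT _ (sub _ _ _ a1 b1 xab).
    by apply: is_derive_eq; rewrite /GRing.scale /=; ring.
  have /andP[? _] := p0M _ (sub _ _ _ a1 b1 xab).
  by rewrite mulr_ge0// subr_ge0 cx.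
pose G sg x := T x - c * P x + M * (c * x + sg * (x * x)).
(* With [sg] equal to [1/2] left of 0 and [-1/2] right of it, [c * x + sg * (x * x)] is a primitive
   of [c - |x|]; each half contributes [M * c^2 / 2]. *)
have inner (sg a b : R) : -1 <= a -> a <= b -> b <= 1 ->
    (forall x : R, a <= x <= b -> `|x| <= c /\ `|x| = - (2 * sg * x)) ->
    G sg a <= G sg b.
  move=> a1 ab b1 cx.
  apply: (@is_derive_ge0_le _ _ _ (G sg) (fun x => (c - `|x|) * (M - p x))) => //.
    move=> x xab; have [_ xE] := cx _ xab.
    have ? := dP _ (sub _ _ _ a1 b1 xab); have ? := dT _ (sub _ _ _ a1 b1 xab).
    by apply: is_derive_eq; rewrite /GRing.scale /= xE; ring.
  move=> x xab; have [xc _] := cx _ xab.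
  have /andP[_ ?] := p0M _ (sub _ _ _ a1 b1 xab).
  by rewrite mulr_ge0// subr_ge0.
have m1 : F (-1) <= F (- c).
  apply: outer => [//|||x /andP[_ xc]]; [lra|lra|].
  by rewrite ler0_norm; lra.
have m2 : G 2^-1 (- c) <= G 2^-1 0.
  apply: inner => [|||x /andP[xc x0]]; [lra|lra|lra|].
  by rewrite ler0_norm//; split; lra.
have m3 : G (- 2^-1) 0 <= G (- 2^-1) c.
  apply: inner => [|||x /andP[x0 xc]]; [lra|lra|lra|].
  by rewrite ger0_norm//; split; lra.
have m4 : F c <= F 1.
  apply: outer => [|//|//|x /andP[xc _]]; first lra.
  by rewrite ger0_norm; lra.
by move: m1 m2 m3 m4; rewrite /F /G; clear; lra.
Qed.

(** * Pointwise bound on the squared modulus *)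

(** The squared modulus of [f + i g], used for both [y] and [y']. *)
Definition sqnorm (R : realType) (f g : R -> R) (x : R) : R :=
  f x * f x + g x * g x.

Lemma sqnorm_ge0 (R : realType) (f g : R -> R) (x : R) : 0 <= sqnorm f g x.
Proof. by rewrite addr_ge0// -expr2 sqr_ge0. Qed.

Lemma abs_cont_on_sqnorm (R : realType) (a b : R) (f g : R -> R) :
  a <= b -> abs_cont_on a b f -> abs_cont_on a b g ->
  abs_cont_on a b (sqnorm f g).
Proof. by move=> *; rewrite /sqnorm; abs_cont_tac. Qed.

Lemma is_derive_sqnorm (R : realType) (f g : R -> R) (df dg x : R) :
  is_derive x 1 f df -> is_derive x 1 g dg ->
  is_derive x 1 (sqnorm f g) (2 * (f x * df + g x * dg)).
Proof. by move=> ? ?; apply: is_derive_eq; rewrite /GRing.scale /=; ring. Qed.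

(** Weighted form of the sup bound: [k D + s P + sg |y|^2] has derivative [k |y' + sg s y|^2].
    Taking [sg = -1] on [[-1, x]] and [sg = 1] on [[x, 1]] and adding gives the claim. *)
Lemma sqnorm_le (R : realType) (u v u1 v1 P D : R -> R) (k s x : R) :
  abs_cont_on (-1) 1 u -> abs_cont_on (-1) 1 v ->
  {ae (@lebesgue_measure R), forall x : R, `[-1, 1]%classic x ->
    is_derive x 1 u (u1 x) /\ is_derive x 1 v (v1 x)} ->
  abs_cont_on (-1) 1 P -> abs_cont_on (-1) 1 D ->
  (forall x : R, -1 <= x <= 1 -> is_derive x 1 P (sqnorm u v x)) ->
  (forall x : R, -1 <= x <= 1 -> is_derive x 1 D (sqnorm u1 v1 x)) ->
  sqnorm u v (-1) = 0 -> sqnorm u v 1 = 0 -> 0 <= k -> k * s = 1 -> -1 <= x <= 1 ->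
  2 * sqnorm u v x <= k * (D 1 - D (-1)) + s * (P 1 - P (-1)).
Proof.
move=> acu acv duv acP acD dP dD pm pp k0 ks /andP[x1 x2].
have le11 : (-1 : R) <= 1 by lra.
have acp := abs_cont_on_sqnorm le11 acu acv.
pose F sg x := k * D x + s * P x + sg * sqnorm u v x.
have mono (sg a b : R) : sg * sg = 1 -> -1 <= a -> a <= b -> b <= 1 ->
    F sg a <= F sg b.
  move=> sg2 a1 ab b1.
  apply: (@abs_cont_on_ae_le R (-1) 1 _ _ (F sg) (fun x =>
    k * ((u1 x + sg * s * u x) ^+ 2 + (v1 x + sg * s * v x) ^+ 2)) _ _ _ _ _ duv)
    => // [|z /andP[az zb] [hu hv]|z _ _].
  - by rewrite /F; abs_cont_tac.
  - have zI : -1 <= z <= 1 by rewrite (le_trans a1)// (le_trans zb).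
    have ? := dP _ zI; have ? := dD _ zI; have ? := is_derive_sqnorm hu hv.
    apply: is_derive_eq; rewrite /GRing.scale /= /sqnorm.
    by ring: sg2 ks.
  - by rewrite mulr_ge0// addr_ge0 ?sqr_ge0.
have := mono (- 1) _ _ _ (lexx _) x1 x2; have := mono 1 _ _ (mulr1 1) x1 x2 (lexx _).
by rewrite /F pm pp mulrNN mulr1 => h1 /(_ erefl) h2; move: h1 h2; clear; lra.
Qed.

(** * Poincare's inequality *)

Lemma inv_weight_bounds (R : realType) (x : R) : -1 <= x <= 1 -> 0 < (2 - x * x)^-1 <= 1.
Proof.
case/andP => x1 x2; have h : 1 <= 2 - x * x by nra.
by rewrite invr_gt0 (lt_le_trans ltr01 h) invf_le1// (lt_le_trans ltr01 h).
Qed.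

(** Riccati equation: for [f = 2 - x^2] and [h = - f' / f], one has [h' = - f'' / f + h^2] with
    [f'' = -2]. *)
Lemma is_derive_weight (R : realType) (x : R) : -1 <= x <= 1 ->
  is_derive x 1 (fun y : R => y * 2 * (2 - y * y)^-1)
    (2 * (2 - x * x)^-1 + (x * 2 * (2 - x * x)^-1) ^+ 2).
Proof.
move=> /inv_weight_bounds/andP[+ _]; rewrite invr_gt0 => /lt0r_neq0 h.
have dq : is_derive x 1 (fun y : R => 2 - y * y) (- (x * 2)).
  by apply: is_derive_eq; rewrite /GRing.scale /=; ring.
have ? := @is_deriveV R (fun y => 2 - y * y) _ _ _ h dq.
by apply: is_derive_eq; rewrite /GRing.scale /=; field.
Qed.

Lemma abs_cont_on_weight (R : realType) :
  abs_cont_on (-1) 1 (fun x : R => x * 2 * (2 - x * x)^-1).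
Proof.
(* The derivative is at most [2 * 1 + 2^2 = 6]. *)
apply: (@abs_cont_on_derive _ _ _ 6) => [x|x xI]; first exact: is_derive_weight.
have /andP[/ltW r0 r1] := inv_weight_bounds xI.
case/andP: xI => x1 x2; rewrite ger0_norm ?addr_ge0 ?sqr_ge0 ?mulr_ge0//.
have : `|x * 2 * (2 - x * x)^-1| <= 2.
  rewrite !normrM (ger0_norm r0) -[leRHS]mulr1 ler_pM// ?mulr_ge0//.
  by rewrite normr_nat -[leRHS]mul1r ler_wpM2r// ler_norml x1.
rewrite -(ler_pXn2r (_ : 0 < 2)%N) ?nnegrE// -normrX ger0_norm ?sqr_ge0//.
by move=> h; lra.
Qed.

(* Picone's identity with the positive function [2 - x^2], for which
   [- (2 - x^2)'' >= 2 - x^2]; the weight below is [- (2 - x^2)' / (2 - x^2)]. *)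
Lemma poincare_sqnorm (R : realType) (u v u1 v1 P D : R -> R) :
  abs_cont_on (-1) 1 u -> abs_cont_on (-1) 1 v ->
  {ae (@lebesgue_measure R), forall x : R, `[-1, 1]%classic x ->
    is_derive x 1 u (u1 x) /\ is_derive x 1 v (v1 x)} ->
  abs_cont_on (-1) 1 P -> abs_cont_on (-1) 1 D ->
  (forall x : R, -1 <= x <= 1 -> is_derive x 1 P (sqnorm u v x)) ->
  (forall x : R, -1 <= x <= 1 -> is_derive x 1 D (sqnorm u1 v1 x)) ->
  sqnorm u v (-1) = 0 -> sqnorm u v 1 = 0 ->
  P 1 - P (-1) <= D 1 - D (-1).
Proof.
move=> acu acv duv acP acD dP dD pm pp.
have le11 : (-1 : R) <= 1 by lra.
have acp := abs_cont_on_sqnorm le11 acu acv.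
have acw := @abs_cont_on_weight R.
pose F x := D x + x * 2 * (2 - x * x)^-1 * sqnorm u v x - P x.
suff : F (-1) <= F 1 by rewrite /F pm pp; clear; lra.
(* The Riccati equation completes the square; the remaining coefficient is nonnegative since
   [2 - x^2 <= 2]. *)
apply: (@abs_cont_on_ae_le R (-1) 1 _ _ F (fun x =>
    (u1 x + x * 2 * (2 - x * x)^-1 * u x) ^+ 2
    + (v1 x + x * 2 * (2 - x * x)^-1 * v x) ^+ 2
    + (2 * (2 - x * x)^-1 - 1) * sqnorm u v x) _ _ _ _ _ duv) => // [|x xI [hu hv]|x xI _].
- by rewrite /F; abs_cont_tac.
- have ? := is_derive_weight xI; have ? := dP _ xI; have ? := dD _ xI.
  have ? := is_derive_sqnorm hu hv.
  by apply: is_derive_eq; rewrite /GRing.scale /= /sqnorm; ring.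
- have /andP[r0 r1] := inv_weight_bounds xI.
  rewrite addr_ge0 ?addr_ge0 ?sqr_ge0// mulr_ge0 ?sqnorm_ge0// subr_ge0.
  rewrite -ler_pdivrMr// invrK mul1r.
  by move: (sqr_ge0 x); clear; lra.
Qed.

(** * Estimates for an eigenfunction *)

(** The equation enters as [y'' = (q - i alpha w) y], split into real and imaginary parts, with
    [Q = - q0]. The bound [1 <= Q] is kept in the conclusion to pass from [Q] to [Q^(3/2)]. *)
Lemma eigenpair_bound (R : realType) (q w u v u1 v1 : R -> R)
    (Q w0 alpha : R) :
  0 < Q -> 0 < w0 -> alpha != 0 ->
  abs_cont_on (-1) 1 u -> abs_cont_on (-1) 1 v ->
  abs_cont_on (-1) 1 u1 -> abs_cont_on (-1) 1 v1 ->
  {ae (@lebesgue_measure R), forall x : R, `[-1, 1]%classic x ->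
    [/\ is_derive x 1 u (u1 x) /\ is_derive x 1 v (v1 x),
        is_derive x 1 u1 (q x * u x + alpha * w x * v x),
        is_derive x 1 v1 (q x * v x - alpha * w x * u x),
        - Q <= q x & w0 * `|x| <= x * w x]} ->
  u (-1) = 0 -> v (-1) = 0 -> u 1 = 0 -> v 1 = 0 ->
  (exists2 x : R, `[-1, 1]%classic x & u x != 0 \/ v x != 0) ->
  1 <= Q /\ `|alpha| * w0 <= 4 * Q.
Proof.
move=> Q0 w00 alpha0 acu acv acu1 acv1 reg um vm up vp [x0 x0I y0].
have le11 : (-1 : R) <= 1 by lra.
have duv : {ae (@lebesgue_measure R), forall x : R, `[-1, 1]%classic x ->
    is_derive x 1 u (u1 x) /\ is_derive x 1 v (v1 x)}.
  case: reg => [N [mN N0 subN]]; exists N; split => //.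
  apply: subset_trans subN; apply: subsetC => x /= H xI.
  by have [] := H xI.
set p := sqnorm u v; set e := sqnorm u1 v1.
have pm : p (-1) = 0 by rewrite /p /sqnorm um vm mulr0 addr0.
have pp : p 1 = 0 by rewrite /p /sqnorm up vp mulr0 addr0.
have acp : abs_cont_on (-1) 1 p by exact: abs_cont_on_sqnorm.
have ace : abs_cont_on (-1) 1 e by exact: abs_cont_on_sqnorm.
have act : abs_cont_on (-1) 1 (fun x => `|x| * p x) by abs_cont_tac.
have [P [Pm acP dP]] := abs_cont_on_primitive le11 acp.
have [D [Dm acD dD]] := abs_cont_on_primitive le11 ace.
have [T [Tm acT dT]] := abs_cont_on_primitive le11 act.
(* [Re (y' conj y)] has derivative [|y'|^2 + q |y|^2] a.e. and vanishes at both ends. *)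
have DQ : D 1 <= Q * P 1.
  pose F x := u x * u1 x + v x * v1 x - D x + Q * P x.
  suff : F (-1) <= F 1 by rewrite /F um vm up vp Pm Dm; clear; lra.
  apply: (@abs_cont_on_ae_le R (-1) 1 _ _ F (fun x => (q x + Q) * p x)
    _ _ _ _ _ reg) => // [|x xI [[hu hv] hu1 hv1 _ _]|x _ [_ _ _ hq _]].
  - by rewrite /F; abs_cont_tac.
  - have ? := dP _ xI; have ? := dD _ xI.
    by apply: is_derive_eq; rewrite /GRing.scale /= /p /e /sqnorm; ring.
  - by rewrite mulr_ge0 ?sqnorm_ge0// -lerBlDr sub0r.
(* The weights [s = sqrt Q] and [k = 1 / s] turn [D 1 <= Q * P 1] into [k * D 1 <= s * P 1]. *)
have [s s0 sQ] : exists2 s : R, 0 < s & s * s = Q.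
  by exists (Num.sqrt Q); rewrite ?sqrtr_gt0// -expr2 sqr_sqrtr// ltW.
have [k k0 ks] : exists2 k : R, 0 < k & k * s = 1.
  by exists s^-1; rewrite ?invr_gt0// mulVf// gt_eqF.
have kD : k * D 1 <= s * P 1.
  have -> : s * P 1 = k * (Q * P 1) by rewrite -sQ; ring: ks.
  by rewrite ler_pM2l.
have p_le x : -1 <= x <= 1 -> p x <= s * P 1.
  move=> xI; have := sqnorm_le acu acv duv acP acD dP dD pm pp (ltW k0) ks xI.
  by rewrite Pm Dm -/p; move: kD; clear; lra.
(* The sup bound at a point where [y] is nonzero forces a positive norm. *)
have P0 : 0 < P 1.
  have x0I' : -1 <= x0 <= 1 by move: x0I; rewrite /= in_itv.
  rewrite -(pmulr_rgt0 _ s0); apply: lt_le_trans (p_le _ x0I').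
  by rewrite /p /sqnorm; case: y0 => ?; [rewrite ltr_pwDl|rewrite ltr_pwDr];
    rewrite -?expr2 ?sqr_ge0// exprn_even_gt0.
have PD : P 1 <= D 1.
  by have := poincare_sqnorm acu acv duv acP acD dP dD pm pp; rewrite Pm Dm !subr0.
have Q1 : 1 <= Q by rewrite -(ler_pM2r P0) mul1r (le_trans PD).
split=> //.
have s1 : 1 <= s by move: s0 sQ Q1; clear; nra.
have k1 : k <= 1 by move: k0 ks s1; clear; nra.
(* The multiplier [c = k / 2] maximises [c * P 1 - s * P 1 * c^2]; it is at most 1 because
   [Q >= 1]. *)
have T1 : P 1 * k / 4 <= T 1.
  have c01 : 0 <= k / 2 <= 1.
    by apply/andP; split; move: k0 k1; clear; lra.
  have := @first_moment_ge R p P T (s * P 1) _ c01 _ dP dT.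
  rewrite Tm Pm !subr0 => H; apply: le_trans (H _).
    by rewrite le_eqVlt; apply/orP; left; apply/eqP; field: ks.
  by move=> x xI; rewrite sqnorm_ge0 p_le.
pose sg := Num.sg alpha.
have sg2 : sg * sg = 1 by rewrite /sg -expr2 sqr_sg alpha0.
(* [Im (y' conj y)] has derivative [- alpha w |y|^2] a.e. and vanishes at both
   ends; the extra factor [x] turns it into the first moment of [|y|^2]. *)
have TD : `|alpha| * w0 * T 1 <= k / 2 * D 1 + s / 2 * P 1.
  pose F x := k / 2 * D x + s / 2 * P x - `|alpha| * w0 * T x
      - sg * (x * (v1 x * u x - u1 x * v x)).
  suff : F (-1) <= F 1 by rewrite /F um vm up vp Tm Pm Dm; clear; lra.
  (* Differentiating the factor [x] leaves [Im (y' conj y)], absorbed as the cross term of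
     [k / 2 * |y' - i s sg y|^2]. *)
  apply: (@abs_cont_on_ae_le R (-1) 1 _ _ F (fun x =>
      k / 2 * ((u1 x + s * sg * v x) ^+ 2 + (v1 x - s * sg * u x) ^+ 2)
      + `|alpha| * (x * w x - w0 * `|x|) * p x) _ _ _ _ _ reg)
    => [//|//|//||x xI [[hu hv] hu1 hv1 _ _]|x _ [_ _ _ _ hw]].
  - by rewrite /F; abs_cont_tac.
  - have ? := dP _ xI; have ? := dD _ xI; have ? := dT _ xI.
    apply: is_derive_eq; rewrite /GRing.scale /= /p /e /sqnorm.
    by rewrite (normrEsg alpha) -/sg; field: sg2 ks.
  - rewrite addr_ge0//.
      by rewrite mulr_ge0 ?divr_ge0 ?addr_ge0 ?sqr_ge0// ltW.
    by rewrite mulr_ge0 ?sqnorm_ge0// mulr_ge0// subr_ge0.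
have aT : `|alpha| * w0 * (P 1 * k / 4) <= s * P 1.
  apply: (@le_trans _ _ (`|alpha| * w0 * T 1)).
    by rewrite ler_wpM2l// mulr_ge0// ltW.
  by move: TD kD; clear; lra.
rewrite -sQ -(ler_pM2r P0) -(ler_pM2r k0).
have -> : 4 * (s * s) * P 1 * k = 4 * (s * P 1) by ring: ks.
by move: aT; clear; lra.
Qed.

(** * Reduction of the complex problem to the real estimates *)

Theorem theorem1p4 (R : realType) (q w : R -> R) (q0 w0 : R) :
  (@lebesgue_measure R).-integrable `[-1, 1]%classic (EFin \o q) ->
  (@lebesgue_measure R).-integrable `[-1, 1]%classic (EFin \o w) ->
  {ae (@lebesgue_measure R), forall x : R, `[-1, 1]%classic x -> q x = q (- x)} ->
  {ae (@lebesgue_measure R), forall x : R, `[-1, 1]%classic x -> w (- x) = - w x} ->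
  {ae (@lebesgue_measure R), forall x : R, `[-1, 1]%classic x -> 0 < x * w x} ->
  q0 < 0 -> 0 < w0 ->
  {ae (@lebesgue_measure R), forall x : R, `[-1, 1]%classic x -> q0 <= q x} ->
  {ae (@lebesgue_measure R), forall x : R, `[-1, 1]%classic x -> w0 <= `|w x|} ->
  forall alpha : R, alpha != 0 ->
    is_eigenvalue q w (0 +i* alpha)%C ->
    `|alpha| <= 4 * (- q0) `^ (3 / 2) / w0.
Proof.
move=> _ _ _ _ xw q00 w00 hq hw alpha alpha0.
move=> [u [v [u1 [v1 [[acu acv acu1 acv1] [duv [eqn [[um vm up vp] nz]]]]]]]].
have [|//||Q1 aQ] := @eigenpair_bound R q w u v u1 v1 (- q0) w0 alpha
  _ _ alpha0 acu acv acu1 acv1 _ um vm up vp nz; first by rewrite oppr_gt0.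
- apply: negligibleS (negligibleU (negligibleU xw hq)
                                  (negligibleU hw (negligibleU duv eqn))).
  rewrite -!setCI; apply: subsetC => x /= [[h1 h2] [h3 [h4 h5]]] xI.
  have [du1 dv1 /eqP] := h5 xI.
  rewrite eq_complex /= => /andP[/eqP re /eqP im].
  (* Positivity of [x w] turns [|w| >= w0] into [x w >= w0 |x|]. *)
  have xwE : x * w x = `|w x| * `|x|.
    by rewrite -normrM mulrC gtr0_norm// mulrC h1.
  split; rewrite ?opprK; [exact: h4| | |exact: h2|].
  + rewrite (_ : _ + _ = derive1 u1 x); last by move: re; clear; lra.
    by rewrite derive1E; exact: (derivableP du1).
  + rewrite (_ : _ - _ = derive1 v1 x); last by move: im; clear; lra.
    by rewrite derive1E; exact: (derivableP dv1).
  + by rewrite xwE ler_wpM2r// h3.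
rewrite ler_pdivlMr// (le_trans aQ)// ler_pM2l//.
(* Since [Q >= 1], [Q = Q^1 <= Q^(3/2)]. *)
by rewrite -[leLHS]powRr1 ?(le_trans ler01)// ler_powR//; lra.
Qed.
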